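(* Let $\Bbbk$ be an infinite field, $R=\Bbbk[x_0,x_1,\dots,x_n]$, and let $I\subset R$ be a homogeneous ideal. Let $L$ be a general linear form. For an integer $d$ let $J=\langle [I]_{\le d}\rangle$ be the ideal generated by the components of $I$ of degree $\le d$. Assume that we have the $d$-binomial expansion $$h_d=\dim_\Bbbk [R/I]_d=\binom{a_d}{d}+\binom{a_{d-1}}{d-1}+\cdots+\binom{a_e}{e},\quad\text{where } e\ge 2.$$ (a) Assume that the multiplication $\times L:[R/I]_d\to[R/I]_{d+1}$ is injective. Then the following conditions are equivalent: (i) $\dim_\Bbbk [R/(I,L)]_d=\big((h_d)_{(d)}\big)|^{-1}_{\phantom{-}0}$ (i.e. Green's Hyperplane Restriction Theorem is sharp for $R/I$ in degree $d$); (ii) the Hilbert function of $R/(I:L)$ has maximal growth from degree $d-1$ to degree $d$; (iii) the Hilbert function of $R/(J:L)$ has maximal growth from degree $d-1$ to degree $d$; (iv) the Hilbert function of $R/J$ has maximal growth from degree $d$ to degree $d+1$. (b) Assume that the multiplication $\times L:[R/I]_{d-1}\to[R/I]_{d}$ is injective. Then the following conditions are equivalent: (i) $\dim_\Bbbk [R/(I,L)]_d=\big((h_d)_{(d)}\big)|^{-1}_{\phantom{-}0}$ (i.e. Green's Hyperplane Restriction Theorem is sharp for $R/I$ in degree $d$); (ii) the Hilbert function of $R/I$ has maximal growth from degree $d-1$ to degree $d$; (iii) the Hilbert function of $R/(J:L)$ has maximal growth from degree $d-1$ to degree $d$.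
   Context: $[M]_d$ denotes the degree $d$ component of a graded module $M$. For positive integers $r,i$, the $i$-binomial expansion of $r$ is the unique expression $r_{(i)}=\binom{r_i}{i}+\binom{r_{i-1}}{i-1}+\cdots+\binom{r_j}{j}$ with $r_i>r_{i-1}>\cdots>r_j\ge j\ge 1$. For integers $a,b$ put $r_{(i)}|^{b}_{a}=\binom{r_i+b}{i+a}+\binom{r_{i-1}+b}{i-1+a}+\cdots+\binom{r_j+b}{j+a}$, where $\binom{m}{c}=0$ whenever $m<c$ or $c<0$; by convention the value for $r=0$ is $0$. Macaulay's theorem states that a standard graded algebra $A$ satisfies $\dim[A]_{t+1}\le\big((\dim[A]_t)_{(t)}\big)|^{+1}_{+1}$ for $t\ge1$; ''the Hilbert function of $A$ has maximal growth from degree $t$ to degree $t+1$'' means that equality holds. Green's Hyperplane Restriction Theorem states that $\dim[R/(I,L)]_d\le\big((\dim[R/I]_d)_{(d)}\big)|^{-1}_{\phantom{-}0}$ for a general linear form $L$; it is sharp in degree $d$ if equality holds. ''General linear form'' means an element of a suitable nonempty Zariski-open subset of $[R]_1$. *)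

(* Defs.v *)
From mathcomp Require Import all_boot all_order all_algebra.
From mathcomp Require Import mpoly.
From Stdlib Require Import ClassicalEpsilon.
From mathcomp Require Import zify.

Set Implicit Arguments.
Unset Strict Implicit.
Unset Printing Implicit Defensive.

Import GRing.Theory.
Local Open Scope ring_scope.

Definition infinite_field (K : fieldType) : Prop :=
  forall s : seq K, exists x : K, x \notin s.

(* The terms are indexed by the lower entry m, running from j to i; values of
   c outside [j, i] are irrelevant. *)
Definition binom_expansion (r i j : nat) (c : nat -> nat) : Prop :=
  [/\ (0 < j <= i)%N, (j <= c j)%N,
      forall m : nat, (j <= m < i)%N -> (c m < c m.+1)%N
    & r = (\sum_(j <= m < i.+1) 'C(c m, m))%N].

Definition binz (x y : int) : nat :=
  match x, y with
  | Posz m, Posz k => 'C(m, k)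
  | _, _ => 0%N
  end.

Definition the_expansion (r i : nat) : nat * (nat -> nat) :=
  epsilon (inhabits (0%N, id)) (fun jc => binom_expansion r i jc.1 jc.2).

(* r_(i)|^b_a; well defined for 0 < i, see [binom_shiftE] *)
Definition binom_shift (r i : nat) (b a : int) : nat :=
  if r == 0%N then 0%N else
  let: (j, c) := the_expansion r i in
  (\sum_(j <= m < i.+1) binz ((c m)%:Z + b) (m%:Z + a))%N.

(* Ideals are Prop-valued predicates, possibly improper: MathComp's idealr
   excludes the unit ideal, which I : L may be. *)

Section Ideals.
Variables (K : fieldType) (n : nat).
Implicit Types (I S : {mpoly K[n]} -> Prop) (p q : {mpoly K[n]}).

Definition is_ideal I : Prop :=
  [/\ I 0, forall p q, I p -> I q -> I (p + q)
    & forall p q, I q -> I (p * q)].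

Definition is_homogeneous I : Prop :=
  forall p d, I p -> I (pihomog mdeg d p).

Definition ideal_gen S : {mpoly K[n]} -> Prop :=
  fun p => forall I, is_ideal I -> (forall q, S q -> I q) -> I p.

Definition ideal_trunc I (d : nat) : {mpoly K[n]} -> Prop :=
  ideal_gen (fun p => I p /\ exists2 i : nat, (i <= d)%N & p \is i.-homog).

Definition ideal_add I (f : {mpoly K[n]}) : {mpoly K[n]} -> Prop :=
  ideal_gen (fun p => I p \/ p = f).

Definition ideal_colon I (f : {mpoly K[n]}) : {mpoly K[n]} -> Prop :=
  fun p => I (p * f).

End Ideals.

Section Hilbert.
Variables (K : fieldType) (n : nat).
Implicit Types (I : {mpoly K[n.+1]} -> Prop).

(* [I]_d as a subspace of [R]_d; see [mem_graded_part] *)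
Definition graded_part I (d : nat) : {vspace dhomog n.+1 K d} :=
  epsilon (inhabits 0%VS)
    (fun V => forall p : dhomog n.+1 K d, p \in V <-> I p).

(* dim [R/I]_d, where [R/I]_d = [R]_d / [I]_d *)
Definition hilb I (d : nat) : nat :=
  (\dim {: dhomog n.+1 K d} - \dim (graded_part I d))%N.

Definition maximal_growth I (t : nat) : Prop :=
  hilb I t.+1 = binom_shift (hilb I t) t 1 1.

(* Injectivity of multiplication by f on classes, [R/I]_d -> R/I *)
Definition mul_injective I (f : {mpoly K[n.+1]}) (d : nat) : Prop :=
  forall p q : dhomog n.+1 K d,
    I (f * p - f * q) -> I ((p : {mpoly K[n.+1]}) - q).

(* Open subsets of [R]_1 = A^(n+1), with the coefficients as coordinates:
   complements of common zero sets of polynomials *)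
Definition zariski_open (U : dhomog n.+1 K 1 -> Prop) : Prop :=
  exists S : {mpoly K[n.+1]} -> Prop,
    forall L : dhomog n.+1 K 1,
      U L <-> exists2 f, S f & f.@[fun i => (L : {mpoly K[n.+1]})@_U_(i)] != 0.

Definition for_general_linear_form (P : dhomog n.+1 K 1 -> Prop) : Prop :=
  exists U : dhomog n.+1 K 1 -> Prop,
    [/\ zariski_open U, exists L, U L & forall L, U L -> P L].

End Hilbert.

Lemma binom_expansion_lt r i j c :
  binom_expansion r i j c -> (r < 'C((c i).+1, i))%N.
Proof.
case=> /andP[j0 ji] jc; elim: i ji r => [|i IHi] ji r hc rE; first by lia.
move: ji; rewrite leq_eqVlt => /orP[/eqP ji|]; last rewrite ltnS => ji.
  rewrite rE ji big_nat1 -ji; case: j j0 jc {ji hc rE IHi} => // j _ jc.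
  by rewrite binS -addn1 leq_add2l bin_gt0 ltnW.
rewrite rE big_nat_recr ?leqW //= binS addnC ltn_add2l.
have hc' m : (j <= m < i)%N -> (c m < c m.+1)%N.
  by move=> /andP[? ?]; apply: hc; lia.
apply: leq_trans (IHi ji _ hc' erefl) _.
by apply: leq_bin2l; apply: hc; rewrite ji /=.
Qed.

Lemma binom_expansion_ge r i j c :
  binom_expansion r i j c -> ('C(c i, i) <= r)%N.
Proof.
by case=> /andP[_ ji] _ _ ->; rewrite big_nat_recr //= leq_addl.
Qed.

Lemma binom_expansion_gt0 r i j c :
  binom_expansion r i j c -> (0 < r)%N.
Proof.
case=> /andP[_ ji] jc _ ->; rewrite big_ltn ?ltnS //.
by rewrite addn_gt0 bin_gt0 jc.
Qed.

Lemma binom_expansion_pred r i j c : (j <= i)%N ->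
  binom_expansion r i.+1 j c ->
  binom_expansion (r - 'C(c i.+1, i.+1)) i j c.
Proof.
move=> ji [/andP[j0 _] jc hc rE]; split; rewrite ?j0 ?ji //.
  by move=> m /andP[? ?]; apply: hc; lia.
by rewrite rE big_nat_recr ?leqW //= addnK.
Qed.

Lemma binom_expansion_uniq r i j j' c c' :
  binom_expansion r i j c -> binom_expansion r i j' c' ->
  j = j' /\ forall m, (j <= m <= i)%N -> c m = c' m.
Proof.
elim: i r => [|i IHi] r h h'; first by case: h => /andP[? ?]; lia.
have le (a a' : nat -> nat) k k' : binom_expansion r i.+1 k a ->
    binom_expansion r i.+1 k' a' -> (a' i.+1 <= a i.+1)%N.
  move=> h1 h2; rewrite leqNgt; apply/negP => lt.
  have := leq_trans (binom_expansion_lt h1) (leq_bin2l i.+1 lt).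
  by rewrite ltnNge (binom_expansion_ge h2).
have ci : c i.+1 = c' i.+1.
  by apply/eqP; rewrite eqn_leq (le _ _ _ _ h h') (le _ _ _ _ h' h).
have top k a : binom_expansion r i.+1 k a -> (i < k)%N ->
    k = i.+1 /\ r = 'C(a i.+1, i.+1).
  case=> /andP[_ ki] _ _ -> ik; have -> : k = i.+1 by lia.
  by rewrite big_nat1.
have [ji|ij] := leqP j i; have [ji'|ij'] := leqP j' i.
- have h2 := binom_expansion_pred ji' h'; rewrite -ci in h2.
  have [-> e] := IHi _ (binom_expansion_pred ji h) h2; split=> // m.
  case/andP=> jm; rewrite leq_eqVlt => /orP[/eqP->//|]; rewrite ltnS => mi.
  by apply: e; rewrite jm.
- have [_ rE] := top _ _ h' ij'.
  have := binom_expansion_gt0 (binom_expansion_pred ji h).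
  by rewrite {1}rE ci subnn.
- have [_ rE] := top _ _ h ij.
  have := binom_expansion_gt0 (binom_expansion_pred ji' h').
  by rewrite {1}rE ci subnn.
have [-> _] := top _ _ h ij; have [-> _] := top _ _ h' ij'.
by split=> // m /andP[? ?]; have -> : m = i.+1 by lia.
Qed.

Lemma binom_expansion_exists r i : (0 < r)%N -> (0 < i)%N ->
  exists j c, binom_expansion r i j c.
Proof.
move=> + i0; case: i i0 => // i _; elim: i r => [|i IHi] r r0.
  exists 1%N, (fun=> r); split; rewrite ?big_nat1 ?bin1 //.
  by move=> m /andP[? ?]; lia.
have ex : exists m, ('C(m, i.+2) <= r)%N by exists 0%N; rewrite bin_small.
have bd m : ('C(m, i.+2) <= r)%N -> (m <= r + i.+2)%N.
  rewrite leqNgt => le; rewrite leqNgt; apply/negP => lt.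
  move/negP: le; apply; have := leq_bin2l i.+2 lt; apply: leq_trans.
  elim: (r) {r0 lt} => [|s IHs]; first by rewrite add0n bin_gt0 leqnSn.
  rewrite addSn binS -addn1 leq_add //.
  by rewrite bin_gt0; lia.
case: (ex_maxnP ex bd) => m le max.
have im : (i.+2 <= m)%N by apply: max; rewrite binn.
have lt : (r < 'C(m, i.+2) + 'C(m, i.+1))%N.
  by rewrite ltnNge; apply/negP; rewrite -binS => /max; rewrite ltnn.
have [s0|s0] := posnP (r - 'C(m, i.+2)).
  exists i.+2, (fun=> m); split; rewrite ?big_nat1 ?leqnn //.
    by move=> k /andP[? ?]; lia.
  by lia.
have [j [c h]] := IHi _ s0.
have cm : (c i.+1 < m)%N.
  rewrite ltnNge; apply/negP => mc.
  have := leq_trans (leq_bin2l i.+1 mc) (binom_expansion_ge h).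
  by lia.
case: h => /andP[j0 ji] jc hc sE.
exists j, (fun k => if k == i.+2 then m else c k); split.
- by rewrite j0 leqW.
- by case: eqP => //; lia.
- move=> k /andP[jk ki]; have [e|ne] := eqVneq k.+1 i.+2.
    have -> : k = i.+1 by lia.
    by rewrite eqn_leq ltnn andbF.
  have -> : (k == i.+2) = false by apply/eqP; lia.
  by apply: hc; lia.
rewrite -[LHS](subnK le) [RHS]big_nat_recr ?(leqW ji) //= sE.
congr (_ + _)%N; last by case: eqP.
apply: eq_big_nat => k /andP[_ ki].
by have -> : (k == i.+2) = false by apply/eqP; lia.
Qed.

Lemma binom_shiftE r i j c b a : binom_expansion r i j c ->
  binom_shift r i b a =
    (\sum_(j <= m < i.+1) binz ((c m)%:Z + b) (m%:Z + a))%N.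
Proof.
move=> h; rewrite /binom_shift.
have := binom_expansion_gt0 h; rewrite lt0n => /negbTE->.
have /= := epsilon_spec (inhabits (0%N, id))
  (fun jc => binom_expansion r i jc.1 jc.2) (ex_intro _ (j, c) h).
rewrite -/(the_expansion r i); case: the_expansion => j' c' /= h'.
have [<- e] := binom_expansion_uniq h h'.
by apply: eq_big_nat => m hm; rewrite e.
Qed.

Lemma mem_graded_part (K : fieldType) (n : nat) (I : {mpoly K[n.+1]} -> Prop)
    (d : nat) (p : dhomog n.+1 K d) :
  is_ideal I -> p \in graded_part I d <-> I p.
Proof.
case=> I0 ID IM; rewrite /graded_part.
suff ex : exists V : {vspace dhomog n.+1 K d}, forall q, q \in V <-> I q.
  exact: (epsilon_spec (inhabits 0%VS) _ ex).
pose sub (V : {vspace dhomog n.+1 K d}) :=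
  forall q : dhomog n.+1 K d, q \in V -> I q.
pose P k : bool :=
  excluded_middle_informative (exists2 V, sub V & \dim V = k).
have PP k : reflect (exists2 V, sub V & \dim V = k) (P k).
  by rewrite /P; case: excluded_middle_informative => h; constructor.
have exP : exists k, P k.
  exists 0%N; apply/PP; exists 0%VS; last exact: dimv0.
  by move=> q; rewrite memv0 => /eqP->.
have bdP k : P k -> (k <= \dim {: dhomog n.+1 K d})%N.
  by case/PP=> V _ <-; apply/dimvS/subvf.
case: (ex_maxnP exP bdP) => k /PP[V sV dV] max; exists V => q.
split=> [|Iq]; first exact: sV.
have sW : sub (V + <[q]>)%VS.
  move=> u /memv_addP[v vV [w /vlineP[x ->] ->]].
  rewrite linearD linearZ /=; apply: ID; first exact: sV.
  by rewrite -mul_mpolyC; apply: IM.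
have /max : P (\dim (V + <[q]>)%VS) by apply/PP; exists (V + <[q]>)%VS.
rewrite -dV => le.
have /eqP -> : V == (V + <[q]>)%VS by rewrite eqEdim addvSl.
by apply: (subvP (addvSr V _)); exact: memv_line.
Qed.

(* Main.v *)
From HB Require Import structures.
Require Import Defs.
From mathcomp Require Import all_boot all_order all_algebra.
From mathcomp Require Import mpoly zify.
From Stdlib Require Import Classical.

Set Implicit Arguments.
Unset Strict Implicit.
Unset Printing Implicit Defensive.

Import GRing.Theory.

(** Write [c(W)] for the codimension of a space [W] of forms of degree [d],
    [W : L] for the forms [p] of degree [d - 1] with [L p] in [W], and [R_1 W]
    for the span of the products of linear forms with [W].  Let [growth] and
    [restr] be the Macaulay and Green bounds.  Multiplication by [L] gives
    [c(W) = c(W + (L)) + c(W : L)], so that with [W = I_d] condition (i) fixes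
    [c(I_d : L)].  Since [e >= 2], subtracting 1 from every entry of the
    [d]-expansion of [c(W)] gives a [(d - 1)]-expansion, and (i) becomes
    [c(W) = growth (c(W : L))]: this is [growth_colon_bound] together with the
    strict monotonicity of [growth].  The injectivity hypotheses identify the
    pieces of [I : L], [J : L] and [J] that occur with [W], [W : L], [R_1 W]
    and [R_1 W : L], and the whole statement is about the single space [W].

    Two inequalities and one persistence statement remain.

    Green's theorem ([green]) is used in the form
    [c(W) <= growth (c(W : M))] for some linear form [M].  This is equivalent
    to the usual one because [x |-> x - restr x] is the left adjoint of
    [growth] ([growth_galois]), and it says something about one subspace
    rather than about an ideal.  It is proved by induction on the degree and on
    [c(W)], restricting to one general hyperplane and then to a second one.
    Macaulay's theorem ([macaulay]) is a consequence, as [W] is contained in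
    [R_1 W : M].

    Gotzmann's persistence theorem ([persistence]) is obtained as in the
    regularity criterion of Bayer and Stillman.  If [X] in degree [d] has
    maximal growth, cutting with [M] such that [R_1 X : M = X] again gives a
    space of maximal growth.  Continuing until every linear form has been killed
    and going back, one finds that the syzygies of [R_1 X] that are linear
    combinations with linear coefficients come from Koszul relations over [X]
    ([max_growing_syzygies]).  This forces [R_1 R_1 X : M = R_1 X]
    ([colon_up_up]), and the Hilbert function can be read off from the
    hyperplane section.

    The form [L] of the theorem can be compared with a general form [M],
    because [X : L = X : M] as soon as [L] and [M] are both injective one degree
    further up: if [L p] is in [X] then [L (M p)] is in [R_1 X], hence [M p] is
    in [X] ([colon_indep]).  So the conclusions drawn for a general form pass to
    each [L] satisfying the injectivity hypothesis. *)

(** * The Macaulay and Green bounds *)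

Definition top_entry (d x : nat) : nat :=
  \max_(b < x + d | 'C(b, d) <= x) b.

(** The greedy expansion of [x] with lower entries [d, ..., 1], summed through
    [F].  It always has [d] terms: once the remainder is 0 the entries are
    [b = i - 1], for which ['C(b, i) = 0].  Recursion on the top entry turns
    every comparison of expansions into an induction on [d]. *)
Fixpoint cascade (F : nat -> nat -> nat) (d x : nat) : nat :=
  if d is d'.+1 then
    let b := top_entry d x in F b d + cascade F d' (x - 'C(b, d))
  else 0.

Definition growth : nat -> nat -> nat := cascade (fun b i => 'C(b.+1, i.+1)).
Definition restr : nat -> nat -> nat := cascade (fun b i => 'C(b.-1, i)).

Lemma bin_lt_top d b x : 'C(b, d.+1) <= x -> b < x + d.+1.
Proof.
move=> bx; rewrite ltnNge; apply/negP => le.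
have : x < 'C(x + d.+1, d.+1).
  elim: x {bx le} => [|x IHx]; first by rewrite bin_gt0.
  by rewrite addSn binS addnC -add1n leq_add // bin_gt0; lia.
by rewrite ltnNge => /negP[]; apply: leq_trans bx; apply: leq_bin2l.
Qed.

Lemma top_entryE d b y : y < 'C(b, d) -> top_entry d.+1 ('C(b, d.+1) + y) = b.
Proof.
move=> yb; set x := (_ + y); apply/eqP; rewrite eqn_leq; apply/andP; split.
  apply/bigmax_leqP => i ix; rewrite leqNgt; apply/negP => bi.
  have := leq_trans (leq_bin2l d.+1 bi) ix.
  by rewrite binS /x leq_add2l leqNgt yb.
have bx : 'C(b, d.+1) <= x by rewrite /x leq_addr.
exact: (leq_bigmax_cond (Ordinal (bin_lt_top bx))).
Qed.

Lemma cascadeE F d b y : y < 'C(b, d) ->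
  cascade F d.+1 ('C(b, d.+1) + y) = F b d.+1 + cascade F d y.
Proof. by move=> yb; rewrite /= (top_entryE yb) addKn. Qed.

Variant cascade_spec d x : Prop :=
  CascadeSpec b y of y < 'C(b, d) & x = 'C(b, d.+1) + y.

Lemma cascadeP d x : cascade_spec d x.
Proof.
have ex : exists b, 'C(b, d.+1) <= x by exists 0.
case: (ex_maxnP ex (fun b bx => ltnW (bin_lt_top bx))) => b bx bmax.
exists b (x - 'C(b, d.+1)); last by rewrite subnKC.
rewrite ltn_subLR // -binS ltnNge; apply/negP => /bmax.
by rewrite ltnn.
Qed.

Lemma cascade0 F d : (forall i, F i i.+1 = 0) -> cascade F d 0 = 0.
Proof.
move=> F0; elim: d => //= d IHd.
by rewrite -[0](bin_small (ltnSn d)) -[X in top_entry _ X]addn0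
  top_entryE ?binn // F0 bin_small // IHd.
Qed.

Lemma growth0 d : growth d 0 = 0.
Proof. by apply: cascade0 => i; rewrite bin_small. Qed.

Lemma restr0 d : restr d 0 = 0.
Proof. by apply: cascade0 => i; rewrite bin_small //; case: i. Qed.

Lemma growthE d b y : y < 'C(b, d) ->
  growth d.+1 ('C(b, d.+1) + y) = 'C(b.+1, d.+2) + growth d y.
Proof. exact: cascadeE. Qed.

Lemma restrE d b y : y < 'C(b, d) ->
  restr d.+1 ('C(b, d.+1) + y) = 'C(b.-1, d.+1) + restr d y.
Proof. exact: cascadeE. Qed.

Lemma growth1 x : growth 1 x = 'C(x.+1, 2).
Proof.
have e : x = 'C(x, 1) + 0 by rewrite bin1 addn0.
by rewrite [in LHS]e growthE ?bin0 // addn0.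
Qed.

Lemma restr1 x : restr 1 x = x.-1.
Proof.
have e : x = 'C(x, 1) + 0 by rewrite bin1 addn0.
by rewrite [in LHS]e restrE ?bin0 // addn0 bin1.
Qed.

Lemma restr_le d x : restr d x <= x.
Proof.
elim: d x => // d IHd x; case: (cascadeP d x) => b y yb ->.
by rewrite restrE // leq_add // leq_bin2l // leq_pred.
Qed.

Lemma growth_lt_bin d b x : x < 'C(b, d) -> growth d x < 'C(b.+1, d.+1).
Proof.
elim: d b x => [|d IHd] b x; first by rewrite bin1.
case: (cascadeP d x) => a y ya -> xb.
have ab : a < b.
  rewrite ltnNge; apply/negP => /(leq_bin2l d.+1) ba.
  by move: (leq_trans xb ba); rewrite ltnNge leq_addr.
rewrite growthE //; apply: leq_trans (leq_bin2l d.+2 (_ : a.+2 <= b.+1)) => //.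
by rewrite [X in _ < X]binS ltn_add2l IHd.
Qed.

(** When [d < b] the bound for [restr] stays strict: this is what keeps the
    expansion of [restr s] greedy, so that [growth] can be applied to it term by
    term. *)
Lemma restr_lt_bin d b x : d < b -> x < 'C(b, d) -> restr d x < 'C(b.-1, d).
Proof.
elim: d b x => [|d IHd] b x db; first by rewrite !bin0.
case: (cascadeP d x) => a y ya -> xb.
have ab : a < b.
  rewrite ltnNge; apply/negP => /(leq_bin2l d.+1) ba.
  by move: (leq_trans xb ba); rewrite ltnNge leq_addr.
have da : d <= a by rewrite leqNgt; apply/negP => /bin_small a0; rewrite a0 in ya.
rewrite restrE //; move: da; rewrite leq_eqVlt => /orP[/eqP da|da].
  have -> : y = 0 by move: ya; rewrite da binn; lia.
  rewrite restr0 addn0 -da bin_small; last by case: (d).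
  by rewrite bin_gt0; lia.
apply: leq_trans (leq_bin2l d.+1 (_ : a <= b.-1)); last by lia.
have e : a = a.-1.+1 by lia.
by rewrite [X in _ < 'C(X, _)]e binS ltn_add2l IHd.
Qed.

Lemma growth_ltn d x y : 0 < d -> x < y -> growth d x < growth d y.
Proof.
move=> d0 xy; have [b] : exists b, y < 'C(b, d).
  exists (y + d); rewrite ltnNge; apply/negP; case: d d0 => // d _.
  by move/bin_lt_top; rewrite ltnn.
elim: d b x y d0 xy => [//|d IHd] B x y _.
case: (cascadeP d x) => a x' xa ->; case: (cascadeP d y) => b y' yb -> xy _.
rewrite !growthE //; have [ab|ba|ab] := ltngtP a b.
- apply: leq_trans (leq_addr _ _).
  apply: leq_trans (leq_bin2l d.+2 (_ : a.+2 <= b.+1)) => //.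
  by rewrite [X in _ < X]binS ltn_add2l growth_lt_bin.
- have := leq_trans _ (leq_bin2l d.+1 ba) => /(_ ('C(b, d.+1) + y').+1).
  by rewrite [X in _ < X]binS ltn_add2l => /(_ yb); lia.
- subst b; rewrite ltn_add2l; move: xy; rewrite ltn_add2l => xy.
  case: d IHd xa yb xy => [|d] IHd xa yb xy; first by rewrite bin0 in yb; lia.
  exact: IHd yb.
Qed.

Lemma leq_growth d x y : 0 < d -> (growth d x <= growth d y) = (x <= y).
Proof.
move=> d0; have [xy|yx|->] := ltngtP x y; last by rewrite leqnn.
  by rewrite ltnW // growth_ltn.
by rewrite leqNgt growth_ltn.
Qed.

Lemma growth_inj d : 0 < d -> injective (growth d).
Proof.
move=> d0 x y e; apply/eqP.
by rewrite eqn_leq -(leq_growth x y d0) -(leq_growth y x d0) e leqnn.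
Qed.

(** Pascal's rule ['C(b + 1, i + 1) = 'C(b, i) + 'C(b, i + 1)] in each term. *)
Lemma growth_restr d s : 0 < d -> growth d s = s + growth d (restr d s).
Proof.
case: d => // d _; elim: d s => [|d IHd] s.
  by rewrite restr1 !growth1; case: s => // s; rewrite binS bin1 addnC.
case: (cascadeP d.+1 s) => b y yb ->; rewrite growthE // restrE //.
have db : d < b by rewrite ltnNge; apply/negP => h; rewrite bin_small in yb.
have gy : restr d.+1 y < 'C(b.-1, d.+1) \/ b = d.+1.
  by case: (ltngtP b d.+1) => h; [lia | left; apply: restr_lt_bin | right].
case: gy => [gy|bd].
  rewrite growthE // IHd [in LHS]binS; have -> : b.-1.+1 = b by lia.
  by lia.
have y0 : y = 0 by move: yb; rewrite bd binn; lia.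
by rewrite bd y0 !restr0 !growth0 bin_small // !binS !bin_small //= growth0.
Qed.

Lemma colon_boundE d b y : y < 'C(b, d.+1) ->
  'C(b, d.+2) + y - restr d.+2 ('C(b, d.+2) + y)
  = 'C(b.-1, d.+1) + (y - restr d.+1 y).
Proof.
move=> yb; rewrite restrE //; case: b yb => // b yb; rewrite [in LHS]binS /=.
have := restr_le d.+1 y; lia.
Qed.

Lemma colon_bound_le_bin d b x : x < 'C(b, d.+1) ->
  x - restr d.+1 x <= 'C(b.-1, d).
Proof.
elim: d b x => [|d IHd] b x.
  by rewrite restr1 bin0; lia.
case: (cascadeP d.+1 x) => a y ya -> xb.
have ab : a < b.
  rewrite ltnNge; apply/negP => /(leq_bin2l d.+2) ba.
  by move: (leq_trans xb ba); rewrite ltnNge leq_addr.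
rewrite colon_boundE //; case: a ya ab {xb} => // a ya ab.
apply: leq_trans (leq_bin2l d.+1 (_ : a.+1 <= b.-1)); last by lia.
by rewrite [X in _ <= X]binS leq_add2l (IHd a.+1).
Qed.

(** Both sides compare the top entry [a] of [x] with the top entry [b] of [y],
    shifted by one; when [a = b + 1] the comparison passes to the remainders. *)
Lemma growth_galois d x y : 0 < d ->
  (x <= growth d y) = (x - restr d.+1 x <= y).
Proof.
move=> d0; have [B] : exists b, y < 'C(b, d).
  exists (y + d); rewrite ltnNge; apply/negP; case: d d0 => // d _.
  by move/bin_lt_top; rewrite ltnn.
elim: d x y B {d0} => [|d IHd] x y B yB.
  have -> : y = 0 by rewrite bin0 in yB; lia.
  by rewrite restr1 /growth /=; lia.
case: (cascadeP d.+1 x) => a x' xa -> {x}.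
case: (cascadeP d y) yB => b y' yb -> {y} yB.
rewrite colon_boundE // growthE //.
have gy := growth_lt_bin yb; have fx := colon_bound_le_bin xa.
have [ab|ba|->] := ltngtP a b.+1.
- have h1 : 'C(a, d.+2) + x' < 'C(b.+1, d.+2).
    apply: leq_trans (leq_bin2l d.+2 ab).
    by rewrite binS ltn_add2l.
  have h2 : 'C(a.-1, d.+1) + 'C(a.-1, d) <= 'C(b, d.+1).
    by case: a {h1 fx} xa ab => // a xa ab; rewrite -binS leq_bin2l.
  by rewrite (leq_trans (ltnW h1)) ?leq_addr // (leq_trans _ (leq_addr _ _)) //
       (leq_trans _ h2) // leq_add2l.
- have h1 : 'C(b.+1, d.+2) + growth d y' < 'C(a, d.+2) + x'.
    apply: leq_trans (leq_addr _ _); apply: leq_trans (leq_bin2l d.+2 ba).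
    by rewrite [X in _ < X]binS ltn_add2l.
  have h2 : 'C(b, d.+1) + y' < 'C(a.-1, d.+1) + (x' - restr d.+1 x').
    apply: leq_trans (leq_addr _ _).
    apply: leq_trans (leq_bin2l d.+1 (_ : b.+1 <= a.-1)); last by lia.
    by rewrite [X in _ < X]binS ltn_add2l.
  by rewrite leqNgt h1 leqNgt h2.
- by rewrite /= !leq_add2l (IHd _ _ _ yb).
Qed.

Lemma colon_bound_growth d y : 0 < d ->
  growth d y - restr d.+1 (growth d y) = y.
Proof.
move=> d0; apply/eqP; rewrite eqn_leq -growth_galois // leqnn /=.
by rewrite -(leq_growth _ _ d0) growth_galois.
Qed.

Lemma restr_growth d y : 0 < d ->
  restr d.+1 (growth d y) = growth d (restr d y).
Proof.
move=> d0; have := colon_bound_growth y d0; have := growth_restr y d0.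
have := restr_le d.+1 (growth d y); lia.
Qed.

Lemma restr_lt d x : 0 < d -> 0 < x -> restr d x < x.
Proof.
move=> d0 x0; rewrite ltn_neqAle restr_le andbT; apply/eqP => e.
have := growth_restr x d0; rewrite e; lia.
Qed.

(** The extra terms of the greedy expansion below the last index [j] vanish,
    because [F] vanishes at the entry [i] over the lower entry [i + 1]. *)
Lemma cascade_expansion F r d j c : (forall i, F i i.+1 = 0) ->
  binom_expansion r d j c -> cascade F d r = \sum_(j <= m < d.+1) F (c m) m.
Proof.
move=> F0; elim: d r => [|d IHd] r h; first by case: h; lia.
have [j0 jc hc rE] := h; have [jd|dj] := leqP j d.
  have h' := binom_expansion_pred jd h.
  rewrite [RHS]big_nat_recr ?leqW // [RHS]addnC -(IHd _ h') -cascadeE.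
    by rewrite subnKC // (binom_expansion_ge h).
  apply: leq_trans (binom_expansion_lt h') (leq_bin2l _ _).
  by apply: hc; rewrite jd /=.
have jE : j = d.+1 by lia.
rewrite rE jE !big_nat1 -[X in cascade _ _ X]addn0 cascadeE ?cascade0 ?addn0 //.
by rewrite bin_gt0 -jE ltnW // (leq_trans dj).
Qed.

Lemma expansion_entry_ge r d j c m :
  binom_expansion r d j c -> j <= m <= d -> m <= c m.
Proof.
case=> [_ jc hc _]; elim: m => // m IHm /andP[]; rewrite leq_eqVlt ltnS.
case/predU1P => [<- _ //|jm md]; apply: leq_ltn_trans (hc m _); last by lia.
by apply: IHm; lia.
Qed.

Lemma binom_shift_growth r d : 0 < d -> binom_shift r d 1 1 = growth d r.
Proof.
move=> d0; have [->|r0] := posnP r; first by rewrite growth0 /binom_shift eqxx.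
have [j [c h]] := binom_expansion_exists r0 d0.
rewrite (binom_shiftE _ _ h) /growth (cascade_expansion _ h) => [|i]; last first.
  by rewrite bin_small.
by apply: eq_bigr => m _; rewrite -!PoszD !addn1.
Qed.

Lemma binom_shift_restr r d : 0 < d -> binom_shift r d (- 1) 0 = restr d r.
Proof.
move=> d0; have [->|r0] := posnP r; first by rewrite restr0 /binom_shift eqxx.
have [j [c h]] := binom_expansion_exists r0 d0.
rewrite (binom_shiftE _ _ h) /restr (cascade_expansion _ h) => [|i]; last first.
  by rewrite bin_small //; case: i.
apply: eq_big_nat => m /andP[jm md]; have [j0 _ _ _] := h.
have := @expansion_entry_ge _ _ _ _ m h _; rewrite jm => /(_ md) mc.
have -> : ((c m)%:Z + -1 = (c m).-1%:Z)%R by lia.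
by rewrite addr0.
Qed.

(** The hypothesis [2 <= e] makes the entries [c m - 1] over [m - 1] a binomial
    expansion: its last lower entry [e - 1] is still positive. *)
Lemma growth_colon_bound r d e c : 2 <= e -> binom_expansion r d.+1 e c ->
  growth d (r - restr d.+1 r) = r.
Proof.
move=> e2 h; have [/andP[e0 ed] ec hc rE] := h.
have r2 : r - restr d.+1 r = \sum_(e.-1 <= m < d.+1) 'C((c m.+1).-1, m).
  rewrite /restr (cascade_expansion _ h) => [|i]; last first.
    by rewrite bin_small //; case: i.
  rewrite {1}rE; case: e e2 e0 ed ec hc rE h => // e e2 e0 ed ec hc rE h.
  rewrite !big_add1 /= -sumnB => [|i _]; last exact/leq_bin2l/leq_pred.
  apply: eq_big_nat => i /andP[ei id].
  have := @expansion_entry_ge _ _ _ _ i.+1 h _; rewrite !ltnS ei => /(_ id).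
  by case: (c i.+1) => // a _; rewrite binS addKn.
have h2 : binom_expansion (r - restr d.+1 r) d e.-1 (fun m => (c m.+1).-1).
  split; rewrite ?r2 //; [by lia| |].
    by rewrite (ltn_predK e2); lia.
  move=> m /andP[em md]; have := hc m.+1.
  have := @expansion_entry_ge _ _ _ _ m.+1 h.
  by lia.
rewrite [in RHS]rE /growth (cascade_expansion _ h2) => [|i]; last first.
  by rewrite bin_small.
rewrite -[in RHS](ltn_predK e2) big_add1 /=.
apply: eq_big_nat => m /andP[em md].
have := @expansion_entry_ge _ _ _ _ m.+1 h; case: (c m.+1) => //; lia.
Qed.

(** * Codimension and linear pencils *)

Local Open Scope ring_scope.

Lemma bounded_max (T : Type) (F : T -> nat) (b : nat) (x0 : T) :
  (forall x, (F x <= b)%N) -> exists x, forall y, (F y <= F x)%N.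
Proof.
move=> Fb; have [n] := ubnP (b - F x0); elim: n x0 => // n IHn x0 le.
have [[y xy]|no] := classic (exists y, (F x0 < F y)%N).
  by apply: (IHn y); have := Fb y; lia.
by exists x0 => y; rewrite leqNgt; apply/negP => xy; apply: no; exists y.
Qed.

Lemma infinite_field_nonroot (K : fieldType) (p : {poly K}) :
  infinite_field K -> p != 0 -> exists t, p.[t] != 0.
Proof.
move=> Kinf p0; apply: NNPP => no.
have [s [us ss]] : exists s : seq K, uniq s /\ size s = size p.
  elim: (size p) => [|k [s [us ss]]]; first by exists [::].
  by have [x xs] := Kinf s; exists (x :: s); rewrite /= xs us ss.
have : (size s < size p)%N; last by rewrite ss ltnn.
apply: max_poly_roots p0 _ us; apply/allP => t _; rewrite /root.
by apply: contraT => h; case: no; exists t.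
Qed.

(** Lower semicontinuity of the rank along a line: suitable factors [E] and
    [F] turn [A] into an identity matrix, and [P] is the determinant of
    [E (A + t B) F], a polynomial in [t] with value 1 at 0. *)
Lemma rank_pencil (K : fieldType) p q (A B : 'M[K]_(p, q)) :
  exists2 P : {poly K}, P != 0 &
    forall t, P.[t] != 0 -> (\rank A <= \rank (A + t *: B)%R)%N.
Proof.
have /row_fullP[E Ec] : row_full (col_base A) by rewrite col_base_full.
have /row_freeP[F Fr] : row_free (row_base A) by rewrite row_base_free.
pose N := E *m B *m F.
pose P := \det (1%:M + 'X *: map_mx polyC N).
have PE t : P.[t] = \det (1%:M + t *: N).
  rewrite -[LHS]/(horner_eval t P) /P -det_map_mx; congr (\det _).
  apply/matrixP => i j; rewrite !mxE rmorphD rmorphM /= /horner_eval.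
  by rewrite hornerX hornerC hornerMn hornerC.
exists P => [|t]; first apply: contra_neq (oner_neq0 K) => P0.
  by rewrite -(det1 K (\rank A)) -[1%:M]addr0 -[in LHS](scale0r N) -PE P0 horner0.
rewrite PE -unitfE -unitmxE -row_free_unit => /eqP rN.
have NE : 1%:M + t *: N = E *m (A + t *: B) *m F.
  rewrite mulmxDr mulmxDl -scalemxAr -scalemxAl; congr (_ + _).
  transitivity (E *m (col_base A *m row_base A) *m F).
    by rewrite mulmxA Ec mul1mx Fr.
  by congr (E *m _ *m F); apply: mulmx_base.
apply: leq_trans (_ : \rank (1%:M + t *: N)%R <= _)%N; first by rewrite rN.
by rewrite NE (leq_trans (mxrankM_maxl _ _) (mxrankM_maxr _ _)).
Qed.

Section Codimension.
Variable K : fieldType.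
Implicit Types V W : vectType K.
Import VectorInternalTheory.

Definition codim V (X : {vspace V}) : nat := (\dim {:V} - \dim X)%N.

Lemma codim_dim V (X : {vspace V}) : (codim X + \dim X = \dim {:V})%N.
Proof. by rewrite subnK // dimvS // subvf. Qed.

Lemma codimS V (X Y : {vspace V}) : (X <= Y)%VS -> (codim Y <= codim X)%N.
Proof. by move=> XY; rewrite leq_sub2l // dimvS. Qed.

Lemma codim_eq V (X Y : {vspace V}) :
  (X <= Y)%VS -> (codim X <= codim Y)%N -> X = Y.
Proof.
move=> XY le; apply/eqP; rewrite eqEdim XY.
by have := codim_dim X; have := codim_dim Y; lia.
Qed.

Lemma codim_fullv V : codim {:V} = 0%N.
Proof. by rewrite /codim subnn. Qed.

Lemma codim0_fullv V (X : {vspace V}) : codim X = 0%N -> X = fullv.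
Proof. by move=> X0; apply: codim_eq (subvf _) _; rewrite X0. Qed.

Lemma codim_preim V W (f : 'Hom(V, W)) (X : {vspace W}) :
  codim X = (codim (X + limg f) + codim (f @^-1: X))%N.
Proof.
have := dimv_sum_cap X (limg f); have := limg_ker_dim f (f @^-1: X).
have := limg_ker_dim f fullv.
rewrite capfv; have /capv_idPr -> : (lker f <= f @^-1: X)%VS.
  by rewrite -lpreim0 lpreimS // sub0v.
rewrite -(lpreim_cap_limg f X) lpreimK ?capvSr //.
have := codim_dim X; have := codim_dim (X + limg f).
have := codim_dim (f @^-1: (X :&: limg f)); lia.
Qed.

Lemma f2mx_linear V W (f g : 'Hom(V, W)) t :
  f2mx (f + t *: g) = f2mx f + t *: f2mx g.
Proof.
have E (h : 'Hom(V, W)) u : u *m f2mx h = v2r (h (r2v u)).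
  by rewrite unlock /= r2vK r2vK.
apply/row_matrixP => i; rewrite linearD linearZ /= !rowE !E.
by rewrite add_lfunE scale_lfunE linearD linearZ.
Qed.

Lemma dim_add_limg V W (f : 'Hom(V, W)) (X : {vspace W}) :
  \dim (X + limg f) = \rank (col_mx (vs2mx X) (f2mx f)).
Proof.
rewrite /dimv /= mx2vsK -addsmxE.
have e : (vs2mx (limg f) :=: f2mx f)%MS.
  by rewrite unlock; apply: eqmx_trans (mx2vsK _) _; rewrite /= genmx1 mul1mx.
by rewrite (adds_eqmx (eqmx_refl _) e).
Qed.

Lemma codim_preim_pencil V W (f g : 'Hom(V, W)) (X : {vspace W}) :
  exists2 P : {poly K}, P != 0 &
    forall t, P.[t] != 0 ->
      (codim (f @^-1: X) <= codim ((f + t *: g) @^-1: X))%N.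
Proof.
have [P P0 le] := rank_pencil (col_mx (vs2mx X) (f2mx f)) (col_mx 0 (f2mx g)).
exists P => // t /le; rewrite scale_col_mx add_col_mx scaler0 addr0 -f2mx_linear.
rewrite -!dim_add_limg => le'.
have le'' : (codim (X + limg (f + t *: g)%R) <= codim (X + limg f))%N.
  by rewrite leq_sub2l.
have := codim_preim f X; rewrite (codim_preim (f + t *: g) X).
move: le''; rewrite -(leq_add2r (codim (f @^-1: X))) => + e.
by rewrite -e leq_add2l.
Qed.

End Codimension.

(** * Graded rings generated in degree one *)

Section GradedRing.

(** The pieces [V d] of a graded commutative ring, with [U] acting as the linear
    forms.  Working with a family of spaces keeps the argument in linear
    algebra: an ideal enters only through one or two of its components. *)
Variables (K : fieldType) (U : vectType K) (V : nat -> vectType K).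
Variable mul : forall d, 'Hom(U, 'Hom(V d, V d.+1)).

Local Notation "L *v p" := (mul _ L p) (at level 40, left associativity).

Definition prodv d (S : {vspace U}) (X : {vspace V d}) : {vspace V d.+1} :=
  (\sum_(i < \dim S) (mul d (vbasis S)`_i @: X))%VS.

Local Notation "S *s X" := (prodv S X) (at level 40, left associativity).
Local Notation up X := (prodv fullv X).
(* hyperplane section and colon space *)
Local Notation "X +s L" := (X + limg (mul _ L))%VS (at level 50).
Local Notation "X :/ L" := (mul _ L @^-1: X)%VS (at level 40).

Lemma mulD d L M (p : V d) : (L + M) *v p = L *v p + M *v p.
Proof. by rewrite linearD add_lfunE. Qed.

Lemma mulZ d t L (p : V d) : (t *: L) *v p = t *: (L *v p).
Proof. by rewrite linearZ scale_lfunE. Qed.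

Lemma mul_suml d I (r : seq I) (P : pred I) (F : I -> U) (p : V d) :
  (\sum_(i <- r | P i) F i) *v p = \sum_(i <- r | P i) F i *v p.
Proof. by rewrite linear_sum sum_lfunE. Qed.

Lemma prodvP d (S : {vspace U}) (X : {vspace V d}) (W : {vspace V d.+1}) :
  (forall L p, L \in S -> p \in X -> L *v p \in W) <-> (S *s X <= W)%VS.
Proof.
split=> [SXW|].
  apply/subv_sumP => i _; apply/subvP => _ /memv_imgP[p pX ->].
  by apply: SXW => //; apply/vbasis_mem/mem_nth; rewrite size_tuple.
move=> /subv_sumP SXW L p LS pX; rewrite (coord_vbasis LS) mul_suml.
apply: memv_suml => i _; rewrite mulZ memvZ //.
by apply: (subvP (SXW i isT)); apply: memv_img.
Qed.

Lemma mem_prodv d (S : {vspace U}) (X : {vspace V d}) L p :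
  L \in S -> p \in X -> L *v p \in S *s X.
Proof. by have /prodvP := subvv (S *s X); apply. Qed.

Lemma mem_up d (X : {vspace V d}) L p : p \in X -> L *v p \in up X.
Proof. exact/mem_prodv/memvf. Qed.

Lemma prodvS d (S T : {vspace U}) (X Y : {vspace V d}) :
  (S <= T)%VS -> (X <= Y)%VS -> (S *s X <= T *s Y)%VS.
Proof.
move=> ST XY; apply/prodvP => L p LS pX.
by rewrite mem_prodv ?(subvP ST) ?(subvP XY).
Qed.

Lemma prodvDl d (S T : {vspace U}) (X : {vspace V d}) :
  ((S + T) *s X = S *s X + T *s X)%VS.
Proof.
apply: subv_anti; rewrite subv_add !prodvS ?subvv ?addvSl ?addvSr ?andbT //.
apply/prodvP => _ p /memv_addP[L LS [M MT ->]] pX.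
by rewrite mulD memv_add ?mem_prodv.
Qed.

Lemma prodvDr d (S : {vspace U}) (X Y : {vspace V d}) :
  (S *s (X + Y) = S *s X + S *s Y)%VS.
Proof.
apply: subv_anti; rewrite subv_add !prodvS ?subvv ?addvSl ?addvSr ?andbT //.
apply/prodvP => L _ LS /memv_addP[p pX [q qY ->]].
by rewrite linearD memv_add ?mem_prodv.
Qed.

Lemma prodv_line d L (X : {vspace V d}) : (<[L]> *s X = mul d L @: X)%VS.
Proof.
apply: subv_anti; apply/andP; split.
  apply/prodvP => _ p /vlineP[t ->] pX.
  by rewrite mulZ memvZ // memv_img.
by apply/subvP => _ /memv_imgP[p pX ->]; rewrite mem_prodv ?memv_line.
Qed.

Lemma prod0v d (X : {vspace V d}) : (0 *s X = 0)%VS.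
Proof.
apply/eqP; rewrite -subv0; apply/prodvP => L p.
by rewrite !memv0 => /eqP -> _; rewrite linear0 zero_lfunE.
Qed.

Lemma prodv_sum d (X : {vspace V d}) r (x : nat -> U) :
  ((\sum_(i < r) <[x i]>) *s X = \sum_(i < r) (mul d (x i) @: X))%VS.
Proof.
elim: r => [|r IHr]; first by rewrite !big_ord0 prod0v.
by rewrite !big_ord_recr prodvDl IHr prodv_line.
Qed.

Lemma memv_sum_mul d (X : {vspace V d}) r (x : nat -> U) p :
  p \in (\sum_(i < r) (mul d (x i) @: X))%VS ->
  exists2 q : nat -> V d, forall i, q i \in X & p = \sum_(i < r) x i *v q i.
Proof.
elim: r p => [|r IHr] p.
  rewrite !big_ord0 memv0 => /eqP ->.
  by exists (fun=> 0); rewrite ?big_ord0 // => _; apply: mem0v.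
rewrite big_ord_recr => /memv_addP[u /IHr[q qX ->] [_ /memv_imgP[v vX ->] ->]].
exists (fun i => if i == r then v else q i) => [i|]; first by case: eqP.
rewrite big_ord_recr /= eqxx; congr (_ + _).
by apply: eq_bigr => i _; rewrite ltn_eqF.
Qed.

Hypothesis mulC : forall d L M (p : V d), L *v (M *v p) = M *v (L *v p).
Hypothesis generated : forall d, up {:V d} = {:V d.+1}%VS.

Lemma prodvCA d S T (X : {vspace V d}) : (S *s (T *s X) = T *s (S *s X))%VS.
Proof.
suff le S' T' : (S' *s (T' *s X) <= T' *s (S' *s X))%VS.
  by apply: subv_anti; rewrite !le.
apply/prodvP => L p LS pTX.
suff /subvP/(_ _ pTX) : (T' *s X <= (T' *s (S' *s X)) :/ L)%VS.
  by rewrite -memv_preim.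
apply/prodvP => M q MT qX; rewrite -memv_preim mulC.
by do 2!rewrite mem_prodv //.
Qed.

Lemma up_adjoin d (X : {vspace V d.+1}) L : up (X +s L) = up X +s L.
Proof. by rewrite prodvDr -!prodv_line prodvCA generated. Qed.

Lemma codim_colon d (W : {vspace V d.+1}) L :
  codim W = (codim (W +s L) + codim (W :/ L))%N.
Proof. exact: codim_preim. Qed.

Hypothesis K_infinite : infinite_field K.

(** Two linear forms that are good for two different spaces are joined by a line,
    and over an infinite field some point of the line is good for both. *)
Lemma exists_common_max d1 (W1 : {vspace V d1.+1}) d2 (W2 : {vspace V d2.+1})
    (L1 L2 : U) :
  exists L, (codim (W1 :/ L1) <= codim (W1 :/ L))%N
         /\ (codim (W2 :/ L2) <= codim (W2 :/ L))%N.
Proof.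
(* the same line [L1 + t (L2 - L1)] is parametrized by [1 - t] from [L2] *)
have [P P0 leP] := codim_preim_pencil (mul d1 L1) (mul d1 (L2 - L1)) W1.
have [Q Q0 leQ] := codim_preim_pencil (mul d2 L2) (mul d2 (L1 - L2)) W2.
have QX0 : Q \Po (1 - 'X) != 0.
  apply: contra_neq Q0 => QX; rewrite -[Q]comp_polyXr.
  have -> : 'X = (1 - 'X) \Po (1 - 'X) :> {poly K}.
    by rewrite rmorphB rmorph1 /= comp_polyX subKr.
  by rewrite comp_polyA QX comp_poly0.
have [t] := infinite_field_nonroot K_infinite (mulf_neq0 P0 QX0).
rewrite hornerM mulf_eq0 negb_or horner_comp hornerD hornerN hornerX hornerC.
case/andP=> Pt Qt; exists (L1 + t *: (L2 - L1)); split.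
  by have := leP t Pt; rewrite -linearZ -linearD.
have := leQ _ Qt; rewrite -linearZ -linearD.
have -> // : L2 + (1 - t) *: (L1 - L2) = L1 + t *: (L2 - L1).
rewrite scalerBl scale1r -scalerN opprB.
by rewrite addrA [L2 + (L1 - L2)]addrC subrK.
Qed.

Lemma generic_colon_gt0 d (W : {vspace V d.+1}) :
  (0 < codim W)%N -> exists L, (0 < codim (W :/ L))%N.
Proof.
move=> W0; apply: NNPP => no; suff We : W = fullv by rewrite We codim_fullv in W0.
apply/eqP; rewrite eqEsubv subvf -generated; apply/prodvP => L p _ _.
rewrite memv_preim; suff -> : W :/ L = fullv by apply: memvf.
apply: codim0_fullv; have [//|WL] := posnP (codim (W :/ L)).
by case: no; exists L.
Qed.

(** Let [H] maximize [s = c(W : H)], and put [c = c(W + (H))], so that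
    [c(W) = c + s].  For [L] good for both [W + (H)] and [W : H], commutativity
    gives [(W : H) + (L) <= (W + (L)) : H], and by the choice of [H]
    [c((W + (H)) : L) <= c((W + (L)) : H) <= c((W : H) + (L)) <= restr s].
    Induction for [W + (H)] yields [c <= growth (restr s)], whence
    [c(W) <= s + growth (restr s) = growth s]. *)
Lemma green d (W : {vspace V d.+1}) :
  exists L, (codim W - restr d.+1 (codim W) <= codim (W :/ L))%N.
Proof.
elim: d W => [|d IHd] W.
  have [W0|W0] := posnP (codim W); first by exists 0; rewrite W0.
  have [L WL] := generic_colon_gt0 W0; exists L.
  by rewrite restr1; lia.
have [n] := ubnP (codim W); elim: n W => // n IHn W Wn.
have [W0|W0] := posnP (codim W); first by exists 0; rewrite W0.
have [L1 WL1] := generic_colon_gt0 W0.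
have [H maxH] : exists H, forall L, (codim (W :/ L) <= codim (W :/ H))%N.
  apply: (@bounded_max _ _ (\dim {:V d.+1}) L1) => L; exact: leq_subr.
have WH := codim_colon W H.
have H0 : (0 < codim (W :/ H))%N := leq_trans WL1 (maxH L1).
have [L2 IH2] : exists L, (codim (W +s H) - restr d.+2 (codim (W +s H))
    <= codim ((W +s H) :/ L))%N by apply: IHn; lia.
have [L3 IH3] := IHd (W :/ H).
have [L [le2 le3]] := exists_common_max (W +s H) (W :/ H) L2 L3.
exists H; rewrite -growth_galois // WH growth_restr // addnC leq_add2l.
rewrite growth_galois //; apply: leq_trans IH2 _; apply: leq_trans le2 _.
have WHL := codim_colon (W +s H) L; have WL := codim_colon W L.
have WLH := codim_colon (W +s L) H; have WcHL := codim_colon (W :/ H) L.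
have sub : ((W :/ H) +s L <= (W +s L) :/ H)%VS.
  rewrite subv_add lpreimS ?addvSl //=; apply/subvP => _ /memv_imgP[p _ ->].
  by rewrite -memv_preim mulC (subvP (addvSr _ _)) // memv_img ?memvf.
have := codimS sub; have := maxH L.
have := restr_le d.+1 (codim (W :/ H)).
have addHL : (W +s H) +s L = (W +s L) +s H.
  by rewrite -!addvA [(limg _ + _)%VS]addvC.
rewrite addHL in WHL; lia.
Qed.

Lemma colon_up_sub d (X : {vspace V d}) L : (X <= up X :/ L)%VS.
Proof. by apply/subvP => p pX; rewrite -memv_preim mem_up. Qed.

(** [X <= W :/ L] turns Green's bound for [W] into Macaulay's. *)
Lemma macaulay d (X : {vspace V d}) (W : {vspace V d.+1}) : (0 < d)%N ->
  (up X <= W)%VS -> (codim W <= growth d (codim X))%N.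
Proof.
move=> d0 XW; have [L] := green W; rewrite -growth_galois // => /leq_trans; apply.
by rewrite leq_growth // codimS // (subv_trans (colon_up_sub X L)) // lpreimS.
Qed.

Definition max_growing d (X : {vspace V d}) : Prop :=
  codim (up X) = growth d (codim X).

(** If [L p] is in [X], then [L (M p) = M (L p)] is in [up X]; thus [M p] is in
    [up X :/ L = X]. *)
Lemma colon_indep d (X : {vspace V d.+1}) L M :
  up X :/ L = X -> up X :/ M = X -> X :/ L = X :/ M.
Proof.
suff le L' M' : up X :/ L' = X -> (X :/ L' <= X :/ M')%VS.
  by move=> XL XM; apply: subv_anti; rewrite !le.
move=> XL; apply/subvP => p; rewrite -!memv_preim => pL.
by rewrite -[in _ \in X]XL -memv_preim mulC mem_up.
Qed.

(** For [L] general, Green's bound for [up X] and maximal growth give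
    [growth (c(X)) <= growth (c(up X :/ L))], hence the equality of spaces; the
    same [L] is taken general for [X] as well. *)
Lemma max_growing_regular d (X : {vspace V d.+1}) : max_growing X ->
  exists L, up X :/ L = X /\
    (codim X - restr d.+1 (codim X) <= codim (X :/ L))%N.
Proof.
move=> maxX; have [L1 le1] := green (up X); have [L2 le2] := green X.
have [L [le3 le4]] := exists_common_max (up X) X L1 L2.
exists L; split; last exact: leq_trans le2 le4.
apply/esym/codim_eq; first exact: colon_up_sub.
rewrite -(@leq_growth d.+1) // -maxX growth_galois //.
exact: leq_trans le1 le3.
Qed.

(** Green's bound gives [<=] for the section [X +s L], and Macaulay's bound
    applied to it gives [>=], since [c(up X +s L)] is already known.  The form
    [L] is arbitrary: Green's bound is taken for a general form and transported
    by [colon_indep]. *)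
Lemma max_growing_section d (X : {vspace V d.+1}) L : max_growing X ->
  up X :/ L = X -> codim (X +s L) = restr d.+1 (codim X) /\ max_growing (X +s L).
Proof.
move=> maxX XL.
have gX := growth_restr (codim X) (ltn0Sn d).
have upE : codim (up X +s L) = growth d.+1 (restr d.+1 (codim X)).
  by have := codim_colon (up X) L; rewrite XL maxX; lia.
have eX : codim (X +s L) = restr d.+1 (codim X).
  apply/eqP; rewrite eqn_leq; apply/andP; split.
    have [M [XM le]] := max_growing_regular maxX.
    have := codim_colon X L; rewrite (colon_indep XL XM).
    by have := restr_le d.+1 (codim X); lia.
  rewrite -(@leq_growth d.+1) // -upE.
  by apply: macaulay => //; rewrite up_adjoin.
by split=> //; rewrite /max_growing up_adjoin upE eX.
Qed.

(** Ideals generated by linear forms are prime as far as linear forms go. *)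
Hypothesis linear_prime : forall d (S : {vspace U}) L (p : V d.+1),
  L \notin S -> L *v p \in S *s {:V d.+1} -> p \in S *s {:V d}.

(** First Koszul homology of the ideal generated by [X], modulo the ideal
    generated by [S], vanishes in degree [d + 3].  The forms [x 0, ..., x (r - 1)]
    are meant to complete [S] to all linear forms, and [w] is an alternating
    matrix of coefficients of Koszul relations. *)
Definition linear_syzygies d (S : {vspace U}) (X : {vspace V d.+1})
    (r : nat) (x : nat -> U) : Prop :=
  forall q : nat -> V d.+2, (forall i, (i < r)%N -> q i \in up X) ->
    \sum_(i < r) x i *v q i \in S *s {:V d.+2} ->
  exists w : nat -> nat -> V d.+1,
    [/\ forall i j, w i j \in X, forall i j, w i j = - w j i,
        forall i, w i i = 0
      & forall i, (i < r)%N ->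
          q i - \sum_(j < r) x j *v w i j \in S *s {:V d.+1}].

Lemma sum_alternating (W : zmodType) r (T : nat -> nat -> W) :
  (forall i j, T i j = - T j i) -> (forall i, T i i = 0) ->
  \sum_(i < r) \sum_(j < r) T i j = 0.
Proof.
move=> TC T0; elim: r => [|r IHr]; first by rewrite big_ord0.
rewrite big_ord_recr /= big_ord_recr /= T0 addr0.
under eq_bigr do rewrite big_ord_recr /=.
rewrite big_split /= IHr add0r -big_split big1 //= => i _.
by rewrite TC addNr.
Qed.

Lemma prodv_fullv_up d (S : {vspace U}) :
  S *s {:V d.+1} = up (S *s {:V d}).
Proof. by rewrite -generated prodvCA. Qed.

(** A relation [L q0 + sum x_i q_i = 0] modulo [S] becomes, modulo [L], a syzygy
    of the section, hence a Koszul combination of some [w].  Lifting [w] to [a]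
    in [X] leaves an error [L s_i]; it lies in [up X], so [s_i] is in
    [up X :/ L = X].  The Koszul terms cancel in [sum x_i q_i], and dividing by
    [L], which is regular modulo [S], expresses [q0] through the [s_i].  Nothing
    is assumed on [q0]: that it falls into [up X] is what [colon_up_up]
    exploits. *)
Lemma lift_syzygies d (S : {vspace U}) (X : {vspace V d.+1}) L r x :
    (S *s {:V d} <= X)%VS -> L \notin S -> up X :/ L = X ->
    linear_syzygies (S + <[L]>)%VS (X +s L) r x ->
  forall (q0 : V d.+2) (q : nat -> V d.+2),
    (forall i, (i < r)%N -> q i \in up X) ->
    L *v q0 + \sum_(i < r) x i *v q i \in S *s {:V d.+2} ->
  exists (a : nat -> nat -> V d.+1) (s : nat -> V d.+1),
    [/\ [/\ forall i j, a i j \in X, forall i j, a i j = - a j i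
           & forall i, a i i = 0],
        forall i, s i \in X,
        forall i, (i < r)%N ->
          q i - (\sum_(j < r) x j *v a i j + L *v s i) \in S *s {:V d.+1}
      & q0 + \sum_(i < r) x i *v s i \in S *s {:V d.+1}].
Proof.
move=> SX LS XL syz q0 q qX; set sum := (X in _ + X) => Sq.
have [||w [wX wC w0 wq]] := syz q.
- by move=> i /qX; apply/subvP/prodvS; rewrite ?subvv ?addvSl.
- rewrite prodvDl prodv_line -[\sum__ _](addKr (L *v q0)) addrC memv_add //.
  by rewrite -linearN memv_img ?memvf.
(* linear projections keep the lifted matrix alternating *)
pose a i j := addv_pi1 X (limg (mul d L)) (w i j).
have aX i j : a i j \in X by exact: memv_pi1.
have aC i j : a i j = - a j i by rewrite /a wC linearN.
have a0 i : a i i = 0 by rewrite /a w0 linear0.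
have wa i j : w i j - a i j \in limg (mul d L).
  by rewrite -(addv_pi1_pi2 (wX i j)) /a addrC addKr memv_pi2.
pose z i := q i - \sum_(j < r) x j *v a i j.
have zS i : (i < r)%N -> z i \in (S *s {:V d.+1} +s L)%VS.
  move=> ir; have -> : z i = (q i - \sum_(j < r) x j *v w i j)
      + \sum_(j < r) x j *v (w i j - a i j).
    under [X in _ = _ + X]eq_bigr do rewrite linearB.
    by rewrite sumrB addrA subrK.
  rewrite memvD //; first by have := wq i ir; rewrite prodvDl prodv_line.
  apply: (subvP (addvSr _ _)); apply: memv_suml => j _.
  have /memv_imgP[b _ ->] := wa i j.
  by rewrite mulC memv_img ?memvf.
pose be i := addv_pi1 (S *s {:V d.+1}) (limg (mul d.+1 L)) (z i).
have beS i : be i \in S *s {:V d.+1}.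
  exact: memv_pi1.
pose s i := if (i < r)%N then (mul d.+1 L)^-1%VF (z i - be i) else 0.
have Ls i : (i < r)%N -> L *v s i = z i - be i.
  move=> ir; rewrite /s ir limg_lfunVK //.
  by rewrite -(addv_pi1_pi2 (zS i ir)) /be addrC addKr memv_pi2.
have sX i : s i \in X.
  have [ir|] := boolP (i < r)%N; last by rewrite /s => /negbTE ->; apply: mem0v.
  rewrite -XL -memv_preim Ls // !memvB ?qX //.
    by apply: memv_suml => j _; rewrite mem_up.
  by apply: (subvP _ _ (beS i)); rewrite prodv_fullv_up prodvS ?subvv.
exists a, s; split=> //.
  by move=> i ir; rewrite Ls // /z opprD addrA subKr.
apply: (linear_prime LS); rewrite linearD /=.
have -> : L *v (\sum_(i < r) x i *v s i)
    = sum - \sum_(i < r) x i *v be i.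
  rewrite linear_sum /=.
  under eq_bigr => i _ do rewrite mulC Ls // /z !linearB /= linear_sum /=.
  rewrite !sumrB -/sum.
  rewrite (@sum_alternating _ _ (fun i j => x i *v (x j *v a i j))) 
    ?subr0 // => [i j|i].
    by rewrite mulC [in LHS]aC !linearN.
  by rewrite a0 !linear0.
rewrite addrA memvB //; apply: memv_suml => i _.
by rewrite prodv_fullv_up mem_up.
Qed.

Lemma syzygies_cons d (S : {vspace U}) (X : {vspace V d.+1}) L r x :
    (S *s {:V d} <= X)%VS -> L \notin S -> up X :/ L = X ->
    linear_syzygies (S + <[L]>)%VS (X +s L) r x ->
  linear_syzygies S X r.+1 (fun i => if i == r then L else x i).
Proof.
move=> SX LS XL syz q qX.
have xE i : (i < r)%N -> (if i == r then L else x i) = x i by move/ltn_eqF->.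
rewrite big_ord_recr /= eqxx addrC; under eq_bigr do rewrite xE //.
case/(lift_syzygies SX LS XL syz) => [i ir|a [s [[aX aC a0] sX qS q0S]]].
  by apply: qX; rewrite ltnS ltnW.
exists (fun i j => if i == r then if j == r then 0 else - s j
                   else if j == r then s i else a i j); split=> [i j|i j|i|i].
- by case: eqP => _; case: eqP => _; rewrite ?memvN ?sX ?aX ?mem0v.
- by case: eqP => _; case: eqP => _; rewrite ?opprK ?oppr0.
- by case: eqP.
rewrite ltnS leq_eqVlt big_ord_recr /= eqxx; case: eqP => [-> _|_ /= ir].
  rewrite linear0 addr0.
  under eq_bigr do rewrite xE // ltn_eqF // linearN.
  by rewrite sumrN opprK.
by under eq_bigr do rewrite xE // ltn_eqF //; apply: qS.
Qed.

(** Descending induction on [S]: killing one more form [L] that is injective on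
    the top degree preserves maximal growth.  Such an [L] lies outside [S]
    unless [X] is everything, when any form will do. *)
Lemma max_growing_syzygies d (S : {vspace U}) (X : {vspace V d.+1}) :
    (S *s {:V d} <= X)%VS -> max_growing X ->
  exists r (x : nat -> U),
    (S + \sum_(i < r) <[x i]>)%VS = fullv /\ linear_syzygies S X r x.
Proof.
have [n] := ubnP (codim S); elim: n S X => // n IHn S X Sn SX maxX.
have [Sf|/subvPn[M _ MS]] := boolP (fullv <= S)%VS.
  exists 0%N, (fun=> 0); rewrite big_ord0 addv0; split.
    by apply/eqP; rewrite eqEsubv subvf.
  move=> q _ _; exists (fun _ _ => 0); split=> // [i j|i j]; first exact: mem0v.
  by rewrite oppr0.
have [L [XL LS]] : exists L, up X :/ L = X /\ L \notin S.
  have [->|Xf] := eqVneq X fullv.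
    exists M; split=> //; apply/eqP; rewrite eqEsubv subvf.
    by apply/subvP => p _; rewrite -memv_preim generated memvf.
  have [L [XL _]] := max_growing_regular maxX; exists L; split=> //.
  apply: contra Xf => LS; rewrite eqEsubv subvf -{1}XL.
  apply/subvP => p _; rewrite -memv_preim.
  have : L *v p \in S *s {:V d.+1} by rewrite mem_prodv ?memvf.
  by rewrite prodv_fullv_up; apply/subvP/prodvS; rewrite ?subvv.
have SSL : (S <= S + <[L]>)%VS := addvSl _ _.
have lt : (codim (S + <[L]>) < codim S)%N.
  rewrite ltnNge; apply/negP => /(codim_eq SSL) e; case/negP: LS.
  by rewrite e (subvP (addvSr _ _)) ?memv_line.
have [_ maxXL] := max_growing_section maxX XL.
have SXL : ((S + <[L]>) *s {:V d} <= X +s L)%VS.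
  by rewrite prodvDl prodv_line addvS.
have [r [x [Sx syz]]] := IHn _ _ (leq_trans lt Sn) SXL maxXL.
exists r.+1, (fun i => if i == r then L else x i); split.
  rewrite -Sx big_ord_recr /= eqxx -addvA [(<[L]> + _)%VS]addvC.
  by congr (_ + (_ + _))%VS; apply: eq_bigr => i _; rewrite ltn_eqF.
exact: syzygies_cons.
Qed.

Lemma colon_up_up d (X : {vspace V d.+1}) L :
  max_growing X -> up X :/ L = X -> up (up X) :/ L = up X.
Proof.
move=> maxX XL; apply/esym/eqP; rewrite eqEsubv colon_up_sub /=.
(* [L = 0] is injective only when [X] is everything *)
have [L0|L0] := eqVneq L 0.
  have Xf : X = fullv.
    apply/eqP; rewrite eqEsubv subvf -XL /=; apply/subvP => p _.
    by rewrite -memv_preim L0 linear0 zero_lfunE mem0v.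
  by rewrite {2}Xf generated subvf.
have LS : L \notin (0%VS : {vspace U}) by rewrite memv0.
have SX : (0%VS *s {:V d} <= X)%VS by rewrite prod0v sub0v.
have [_ maxXL] := max_growing_section maxX XL.
have SXL : ((0 + <[L]>) *s {:V d} <= X +s L)%VS.
  by rewrite add0v prodv_line addvSr.
have [r [x [Sx syz]]] := max_growing_syzygies SXL maxXL.
apply/subvP => p; rewrite -memv_preim.
have -> : up (up X) = (<[L]> + \sum_(i < r) <[x i]>)%VS *s up X.
  by rewrite -Sx add0v.
rewrite prodvDl prodv_line prodv_sum => /memv_addP[_ /memv_imgP[q0 q0X ->]].
case=> _ /memv_sum_mul[q qX ->] /= e.
have [|a [s [_ sX _]]] :=
  lift_syzygies SX LS XL syz (fun i _ => qX i) (q0 := q0 - p).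
  by rewrite linearB /= e opprD addrA subrr add0r addNr mem0v.
rewrite prod0v memv0 addrAC subr_eq0 => /eqP <-.
by rewrite memvD // memv_suml // => i _; rewrite mem_up.
Qed.

(** By induction on [c(X)], the section [X +s L] has persistent growth, and
    [L] is injective in the degrees of [X] and [up X]; add up the codimensions. *)
Theorem persistence d (X : {vspace V d.+1}) : max_growing X -> max_growing (up X).
Proof.
have [n] := ubnP (codim X); elim: n X => // n IHn X Xn maxX.
have [X0|X0] := posnP (codim X).
  by rewrite /max_growing (codim0_fullv X0) !generated !codim_fullv growth0.
have [L [XL _]] := max_growing_regular maxX.
have [cXL maxXL] := max_growing_section maxX XL.
have /IHn/(_ maxXL) : (codim (X +s L) < n)%N.
  by rewrite cXL (leq_trans (restr_lt _ X0)).
have := codim_colon (up (up X)) L; rewrite (colon_up_up maxX XL).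
rewrite /max_growing -!up_adjoin => -> ->; rewrite maxXL cXL maxX.
by rewrite -restr_growth // addnC -growth_restr.
Qed.

(** * Sharpness of Green's bound in one degree *)

Section SharpGreen.

Variables (d : nat) (W : {vspace V d.+2}) (L : U).

Lemma green_sharpP :
    growth d.+1 (codim W - restr d.+2 (codim W)) = codim W ->
  codim (W +s L) = restr d.+2 (codim W) <->
  codim W = growth d.+1 (codim (W :/ L)).
Proof.
move=> Wg; have cW := codim_colon W L; have := restr_le d.+2 (codim W).
split=> [e|]; first by rewrite -{1}Wg; congr growth; lia.
by rewrite -{1}Wg => /growth_inj e; have := e isT; lia.
Qed.

(** Growth into [W] from below against growth out of [W].  From left to right
    [up (W :/ L) <= W], and Macaulay's bound turns this into an equality, so that
    persistence applies to [W :/ L]. *)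
Lemma sharp_iff_max_growing : up W :/ L = W ->
    growth d.+1 (codim W - restr d.+2 (codim W)) = codim W ->
  codim W = growth d.+1 (codim (W :/ L)) <-> max_growing W.
Proof.
move=> WL Wg; split=> [cW|maxW]; last first.
  by apply/green_sharpP => //; have [] := max_growing_section maxW WL.
have YW : (up (W :/ L) <= W)%VS.
  rewrite -[X in (_ <= X)%VS]WL; apply/prodvP => M p _.
  by rewrite -!memv_preim => pL; rewrite mulC mem_up.
have upY : up (W :/ L) = W by apply: codim_eq; rewrite // cW macaulay.
have maxY : max_growing (W :/ L) by rewrite /max_growing upY.
by have := persistence maxY; rewrite upY.
Qed.

(** If [W] has the codimension allowed by Macaulay's bound, then [W = up X], and
    [colon_up_up] gives [up W :/ L = W]. *)
Lemma sharp_iff_colon_growth (X : {vspace V d.+1}) :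
    (up X <= W)%VS -> W :/ L = X ->
  codim W = growth d.+1 (codim X) <-> codim (up W :/ L) = growth d.+1 (codim X).
Proof.
move=> XW WL; have le := macaulay (ltn0Sn d) XW.
split=> [cW|cWL]; last first.
  by apply/eqP; rewrite eqn_leq le -cWL codimS // colon_up_sub.
have upX : up X = W by apply: codim_eq; rewrite // cW macaulay.
have maxX : max_growing X by rewrite /max_growing upX.
by have -> : up W :/ L = W by rewrite -upX (colon_up_up maxX) // upX.
Qed.

End SharpGreen.

End GradedRing.

(** * The polynomial ring *)

Section PolynomialRing.

Variables (K : fieldType) (n : nat).
Local Notation R := (dhomog n.+1 K).
Implicit Types (p q : {mpoly K[n.+1]}) (I : {mpoly K[n.+1]} -> Prop).

Definition mulh d (L : R 1) (p : R d) : R d.+1 :=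
  DHomog (dhomogM (valP L) (valP p)).

Lemma mulh_linear d L : linear (@mulh d L).
Proof. by move=> t p q; apply: val_inj; rewrite /= mulrDr -scalerAr. Qed.

HB.instance Definition _ d L :=
  GRing.isLinear.Build K (R d) (R d.+1) _ (@mulh d L) (mulh_linear L).

Definition mull d (L : R 1) : 'Hom(R d, R d.+1) := linfun (@mulh d L).

Lemma mull_linear d : linear (@mull d).
Proof.
move=> t L M; apply/lfunP => p; rewrite add_lfunE scale_lfunE !lfunE /=.
by apply: val_inj; rewrite /= mulrDl -scalerAl.
Qed.

HB.instance Definition _ d :=
  GRing.isLinear.Build K (R 1) 'Hom(R d, R d.+1) _ (@mull d) (@mull_linear d).

Definition pmul d : 'Hom(R 1, 'Hom(R d, R d.+1)) := linfun (@mull d).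

Lemma pmulE d (L : R 1) (p : R d) :
  pmul d L p = (L : {mpoly K[n.+1]}) * p :> {mpoly K[n.+1]}.
Proof. by rewrite lfunE /= lfunE. Qed.

Lemma pmulC d (L M : R 1) (p : R d) :
  pmul d.+1 L (pmul d M p) = pmul d.+1 M (pmul d L p).
Proof. by apply: val_inj; rewrite /= !pmulE mulrCA. Qed.

Lemma var_homog i : 'X_i \is [in K[n.+1], 1.-homog].
Proof. by rewrite dhomogX; apply/eqP/mdeg1. Qed.

Definition var i : R 1 := DHomog (var_homog i).

Lemma mpolyX_recl (m : 'X_{1..n.+1}) d : mdeg m = d.+1 ->
  exists i m', mdeg m' = d /\ 'X_[m] = 'X_i * 'X_[m'] :> {mpoly K[n.+1]}.
Proof.
move=> md; have [i mi] : exists i, (0 < m i)%N.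
  apply/existsP; apply: contraT; rewrite negb_exists => /forallP m0.
  have : mdeg m = 0%N; last by rewrite md.
  by rewrite mdegE big1 // => i _; apply/eqP; rewrite -leqn0 leqNgt m0.
have mE : m = (U_(i) + (m - U_(i)))%MM.
  rewrite addmC submK //; apply/mnm_lepP => j; rewrite mnm1E.
  by case: eqP => // <-.
exists i, (m - U_(i))%MM; split; last by rewrite -mpolyXD -mE.
by move: md; rewrite {1}mE mdegD mdeg1 add1n => -[].
Qed.

Lemma dhomog_sum_vars d (p : R d.+1) :
  exists q : 'I_n.+1 -> R d, p = \sum_i pmul d (var i) (q i).
Proof.
suff [q pq] : exists q : 'I_n.+1 -> R d,
    val p = \sum_i 'X_i * (q i : {mpoly K[n.+1]}).
  exists q; apply: val_inj; rewrite pq /= raddf_sum.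
  by apply: eq_bigr => i _; rewrite /= pmulE.
rewrite {1}[val p]mpolyE; have /dhomogP := dhomog_is_dhomog p.
move: (val p) => /= {}p; elim: (msupp p) => [_|m s IHs ms].
  by exists (fun=> 0); rewrite big_nil big1 // => i _; rewrite mulr0.
have [|q qE] := IHs; first by move=> m' m's; apply: ms; rewrite inE m's orbT.
have [i [m' [m'd mE]]] := mpolyX_recl (ms m (mem_head _ _)).
have X1 : 'X_[m'] \is [in K[n.+1], d.-homog] by rewrite dhomogX; apply/eqP.
exists (fun j => q j + (p@_m *+ (j == i)) *: DHomog X1).
rewrite big_cons qE mE addrC; under [in RHS]eq_bigr do rewrite linearD mulrDr /=.
rewrite big_split /=; congr (_ + _).
rewrite (bigD1 i) //= eqxx mulr1n big1 => [|j /negbTE->].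
  by rewrite addr0 scalerAr.
by rewrite scale0r mulr0.
Qed.

Lemma pmul_generated d : prodv pmul fullv {:R d} = {:R d.+1}%VS.
Proof.
apply/eqP; rewrite eqEsubv subvf; apply/subvP => p _.
have [q ->] := dhomog_sum_vars p.
by apply: memv_suml => i _; rewrite mem_prodv ?memvf.
Qed.

Lemma dhomog0_const (p : R 0) : val p = ((val p)@_0%MM)%:MP.
Proof.
apply/mpolyP => m; rewrite mcoeffC; have [->|m0] := eqVneq m 0%MM.
  by rewrite mulr1.
rewrite mulr0 (dhomog_nemf_coeff (dhomog_is_dhomog p)) //.
by rewrite -mdeg_eq0 in m0.
Qed.

Lemma linear_form_sum (L : R 1) :
  exists c : 'I_n.+1 -> K, L = \sum_i c i *: var i.
Proof.
have [q ->] := dhomog_sum_vars L.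
exists (fun i => (val (q i))@_0%MM); apply: eq_bigr => i _.
by apply: val_inj; rewrite /= pmulE -mul_mpolyC mulrC -dhomog0_const.
Qed.

Section Substitution.

Variable S : {vspace R 1}.

(** The substitution sending each linear form [L] to [L - projv S L].  Its kernel
    is the ideal generated by [S], which is therefore prime. *)
Definition kill_forms : (n.+1).-tuple {mpoly K[n.+1]} :=
  [tuple val (var i - projv S (var i)) | i < n.+1].

Lemma kill_forms_var i : 'X_i \mPo kill_forms = val (var i - projv S (var i)).
Proof. by rewrite comp_mpolyXU -tnth_nth tnth_mktuple. Qed.

Lemma kill_forms_linear (L : R 1) :
  val L \mPo kill_forms = val (L - projv S L).
Proof.
have [c ->] := linear_form_sum L.
rewrite [projv S _]linear_sum -sumrB !raddf_sum; apply: eq_bigr => i _ /=.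
by rewrite !linearZ /= kill_forms_var /= -scalerDr.
Qed.

Lemma kill_forms_eq0 (L : R 1) : (val L \mPo kill_forms == 0) = (L \in S).
Proof.
rewrite kill_forms_linear; apply/eqP/idP => [e|LS]; last first.
  by rewrite projv_id // subrr.
have /eqP : L - projv S L = 0 by apply: val_inj.
by rewrite subr_eq0 => /eqP ->; apply: memv_proj.
Qed.

Lemma kill_forms_prodv d (p : R d.+1) :
  p \in prodv pmul S {:R d} -> val p \mPo kill_forms = 0.
Proof.
case/memv_sumP => v vS ->; rewrite !raddf_sum big1 //= => i _.
have /memv_imgP[u _ ->] := vS i isT; rewrite pmulE rmorphM /=.
have /eqP -> : val (vbasis S)`_i \mPo kill_forms == 0; last exact: mul0r.
by rewrite kill_forms_eq0 vbasis_mem // mem_nth // size_tuple.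
Qed.

(** Every form is congruent to its image modulo [S].  The inductive step is proved
    for an abstract relation [P] between a form and its image because in degree 0
    the congruence is an equality. *)
Lemma kill_forms_residue d (p : R d.+1) :
  exists2 q : R d.+1, val p \mPo kill_forms = val q
    & p - q \in prodv pmul S {:R d}.
Proof.
have base (p0 : R 0) : val p0 \mPo kill_forms = val p0.
  by rewrite dhomog0_const comp_mpolyC.
have step e (P : R e -> R e -> Prop) :
    (forall u : R e, exists v, P u v) ->
    (forall u v, P u v -> val u \mPo kill_forms = val v /\
      forall L : R 1, pmul e L (u - v) \in prodv pmul S {:R e}) ->
    forall u : R e.+1, exists2 v : R e.+1, val u \mPo kill_forms = val v
      & u - v \in prodv pmul S {:R e}.
  move=> exP PP u; have [q ->] := dhomog_sum_vars u.
  have [f fP] := fin_all_exists (fun i => exP (q i)).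
  exists (\sum_i pmul e (var i - projv S (var i)) (f i)).
    rewrite !raddf_sum; apply: eq_bigr => i _ /=.
    have [qf _] := PP _ _ (fP i).
    by rewrite !pmulE rmorphM /= kill_forms_var qf.
  rewrite -sumrB; apply: memv_suml => i _.
  have [_ /(_ (var i - projv S (var i))) h] := PP _ _ (fP i).
  rewrite -[pmul e (var i) _](subrK
    (pmul e (var i - projv S (var i)) (q i))) -addrA.
  rewrite memvD -?linearB //.
  by rewrite -opp_lfunE -add_lfunE -linearB /= subKr mem_prodv ?memv_proj ?memvf.
elim: d p => [|d IHd] p.
  apply: (step 0%N (fun u v => u = v)) => [u|u _ <-]; first by exists u.
  by split=> // L; rewrite subrr linear0 mem0v.
pose P u v := val u \mPo kill_forms = val v /\ u - v \in prodv pmul S {:R d}.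
apply: (step d.+1 P) => [u|u v [uv uvS]].
  by have [v uv uvS] := IHd u; exists v.
split=> // L; rewrite (prodv_fullv_up pmulC pmul_generated).
exact: mem_up.
Qed.

Lemma pmul_prime d (L : R 1) (p : R d.+1) : L \notin S ->
  pmul d.+1 L p \in prodv pmul S {:R d.+1} -> p \in prodv pmul S {:R d}.
Proof.
move=> LS /kill_forms_prodv /eqP; rewrite /= pmulE rmorphM /=.
rewrite mulf_eq0 kill_forms_eq0 (negbTE LS) /= => /eqP p0.
have [q pq] := kill_forms_residue p.
have -> : q = 0 by apply: val_inj; rewrite /= -pq.
by rewrite subr0.
Qed.

End Substitution.

End PolynomialRing.

(** * Homogeneous components of ideals *)

Section GradedPieces.

Variables (K : fieldType) (n : nat).
Local Notation R := (dhomog n.+1 K).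
Implicit Types (p q : {mpoly K[n.+1]}) (I : {mpoly K[n.+1]} -> Prop).

Lemma ideal_genP (S : {mpoly K[n.+1]} -> Prop) : is_ideal (ideal_gen S).
Proof.
split=> [I [I0 _ _] _ //|p q Ip Iq I hI SI|p q Iq I hI SI].
  by have [_ ID _] := hI; apply: ID; [exact: Ip | exact: Iq].
by have [_ _ IM] := hI; apply: IM; exact: Iq.
Qed.

Lemma ideal_gen_sub (S : {mpoly K[n.+1]} -> Prop) p : S p -> ideal_gen S p.
Proof. by move=> Sp I _; apply. Qed.

Lemma ideal_colonP I f : is_ideal I -> is_ideal (ideal_colon I f).
Proof.
case=> I0 ID IM; rewrite /ideal_colon; split=> [|p q|p q].
- by rewrite mul0r.
- by rewrite mulrDl; apply: ID.
- by rewrite -mulrA; apply: IM.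
Qed.

Lemma mul_linear_mnm_homog (L : R 1) m :
  val L * 'X_[m] \is [in K[n.+1], ((mdeg m).+1).-homog].
Proof.
apply: (dhomogM (d := 1%N)); first exact: dhomog_is_dhomog.
by rewrite dhomogX.
Qed.

Lemma pihomog_mul_linear (L : R 1) d p :
  pihomog mdeg d.+1 (val L * p) = val L * pihomog mdeg d p.
Proof.
elim/mpolyind: p => [|c m p _ _ IHp]; first by rewrite mulr0 !pihomog0 mulr0.
rewrite mulrDr !pihomogD mulrDr IHp; congr (_ + _).
rewrite -scalerAr !linearZ /= -scalerAr.
congr (_ *: _); rewrite pihomogX.
have LX := mul_linear_mnm_homog L m.
case: eqP => [md|md]; first by rewrite pihomog_dE // -md.
by rewrite (pihomog_ne0 _ LX) ?mulr0 // eqSS; apply/eqP.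
Qed.

Lemma pihomog0_mul_linear (L : R 1) p : pihomog mdeg 0 (val L * p) = 0.
Proof.
elim/mpolyind: p => [|c m p _ _ IHp]; first by rewrite mulr0 pihomog0.
rewrite mulrDr pihomogD IHp addr0 -scalerAr linearZ /=.
have LX := mul_linear_mnm_homog L m.
by rewrite (pihomog_ne0 _ LX) ?scaler0.
Qed.

Lemma graded_colon I (L : R 1) d : is_ideal I ->
  graded_part (ideal_colon I L) d = (pmul K n d L @^-1: graded_part I d.+1)%VS.
Proof.
move=> hI; apply/vspaceP => p; rewrite -memv_preim; apply/idP/idP.
  move/(mem_graded_part _ (ideal_colonP _ hI)) => Ip.
  by apply/mem_graded_part => //; rewrite pmulE mulrC.
move/(mem_graded_part _ hI) => Ip.
apply/mem_graded_part; first exact: ideal_colonP.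
by rewrite /ideal_colon mulrC -pmulE.
Qed.

Lemma ideal_addP I (f : {mpoly K[n.+1]}) p : is_ideal I -> ideal_add I f p ->
  exists a b, I a /\ p = a + f * b.
Proof.
move=> [I0 ID IM]; pose T q := exists a b, I a /\ q = a + f * b.
apply: (_ : ideal_add I f p -> T p); apply; last first.
  move=> q [Iq|->]; first by exists q, 0; rewrite mulr0 addr0.
  by exists 0, 1; rewrite mulr1 add0r.
split=> [|_ _ [a [b [Ia ->]]] [c [e [Ic ->]]]|q _ [a [b [Ia ->]]]].
- by exists 0, 0; rewrite mulr0 addr0.
- by exists (a + c), (b + e); split; [apply: ID | rewrite mulrDr addrACA].
- by exists (q * a), (q * b); split; [apply: IM | rewrite mulrDr mulrCA].
Qed.

Lemma graded_add I (L : R 1) d : is_ideal I -> is_homogeneous I ->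
  graded_part (ideal_add I L) d.+1 =
    (graded_part I d.+1 + limg (pmul K n d L))%VS.
Proof.
move=> hI homI; have hA := ideal_genP (fun p => I p \/ p = L).
apply/vspaceP => p; apply/idP/idP.
  move/(mem_graded_part _ hA)/(ideal_addP hI) => [a [b [Ia pE]]].
  pose a' : R d.+1 := DHomog (pihomogP mdeg d.+1 a).
  pose b' : R d := DHomog (pihomogP mdeg d b).
  have -> : p = a' + pmul K n d L b'.
    apply: val_inj; rewrite /= pmulE -pihomog_mul_linear -pihomogD -pE.
    by rewrite pihomog_dE // dhomog_is_dhomog.
  rewrite memv_add ?memv_img ?memvf //; apply/mem_graded_part => //.
  exact: homI.
case/memv_addP => a /(mem_graded_part _ hI) Ia [_ /memv_imgP[b _ ->] ->].
apply/(mem_graded_part _ hA); have [_ AD AM] := hA; apply: AD.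
  by apply: ideal_gen_sub; left.
by rewrite /= pmulE mulrC; apply: AM; apply: ideal_gen_sub; right.
Qed.

Lemma ideal_truncP I d : is_ideal (ideal_trunc I d).
Proof. exact: ideal_genP. Qed.

Lemma graded_trunc I d : is_ideal I ->
  graded_part (ideal_trunc I d) d = graded_part I d.
Proof.
move=> hI; apply/vspaceP => p; apply/idP/idP.
  move/(mem_graded_part _ (ideal_truncP _ _)) => Jp.
  by apply/mem_graded_part => //; apply: Jp => // q [].
move/(mem_graded_part _ hI) => Ip; apply/(mem_graded_part _ (ideal_truncP _ _)).
apply: ideal_gen_sub; split=> //; exists d => //; exact: dhomog_is_dhomog.
Qed.

(** To be an ideal it suffices to be closed under scalars and variables. *)
Lemma mpoly_mul_closed (T : {mpoly K[n.+1]} -> Prop) :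
  T 0 -> (forall p q, T p -> T q -> T (p + q)) ->
  (forall c p, T p -> T (c *: p)) ->
  (forall i p, T p -> T ('X_i * p)) ->
  forall p q, T q -> T (p * q).
Proof.
move=> T0 TD TZ TX p q Tq; elim/mpolyind: p => [|c m p _ _ IHp].
  by rewrite mul0r.
rewrite mulrDl -scalerAl; apply/TD => //; apply: TZ => {c p IHp}.
have [d] := ubnP (mdeg m); elim: d m => // d IHd m md.
have [m0|m0] := posnP (mdeg m).
  by move/eqP: m0; rewrite mdeg_eq0 => /eqP ->; rewrite mpolyX0 mul1r.
have [i [m' [m'd ->]]] := mpolyX_recl K (esym (prednK m0)).
by rewrite -mulrA; apply/TX/IHd; lia.
Qed.

(** The polynomials whose components of degree at most [d] lie in [I], and whose
    component of degree [d + 1] is a combination of linear multiples of [I_d],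
    form an ideal containing the generators of the truncation. *)
Lemma graded_trunc_up I d : is_ideal I ->
  graded_part (ideal_trunc I d) d.+1 = prodv (pmul K n) fullv (graded_part I d).
Proof.
move=> hI; have hJ := ideal_truncP I d; have [I0 ID IM] := hI.
apply/vspaceP => p; apply/idP/idP; last first.
  move: p; apply/subvP/prodvP => L p _ pI.
  apply/mem_graded_part => //; rewrite pmulE; have [_ _ JM] := hJ; apply: JM.
  by apply/mem_graded_part => //; rewrite graded_trunc.
move/(mem_graded_part _ hJ) => Jp; set W := prodv _ _ _.
pose T q := (forall k, (k <= d)%N -> I (pihomog mdeg k q)) /\
  exists2 u : R d.+1, u \in W & pihomog mdeg d.+1 q = val u.
suff [_ [u uW pu]] : T (val p).
  suff -> : p = u by [].
  by apply: val_inj; rewrite -pu pihomog_dE // dhomog_is_dhomog.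
have T0 : T 0.
  split=> [k _|]; first by rewrite pihomog0.
  by exists 0; rewrite ?mem0v // pihomog0.
have TD q1 q2 : T q1 -> T q2 -> T (q1 + q2).
  move=> [h1 [u1 u1W e1]] [h2 [u2 u2W e2]]; split=> [k kd|].
    by rewrite linearD; apply: ID; [apply: h1 | apply: h2].
  by exists (u1 + u2); rewrite ?memvD // linearD /= e1 e2.
apply: Jp; last first.
  move=> q [Iq [i id qi]]; split=> [k kd|].
    have [->|ki] := eqVneq k i; first by rewrite pihomog_dE.
    by rewrite (pihomog_ne0 _ qi) // eq_sym.
  by exists 0; rewrite ?mem0v // (pihomog_ne0 _ qi) //; lia.
split=> //; apply: mpoly_mul_closed => // [c q [h [u uW e]]|i q [h [u uW e]]].
  split=> [k kd|]; first by rewrite linearZ /= -mul_mpolyC; apply/IM/h.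
  by exists (c *: u); rewrite ?memvZ // linearZ /= e.
have XE : 'X_i = val (var K i) by [].
rewrite XE; split=> [[|k] kd|].
- by rewrite pihomog0_mul_linear.
- by rewrite pihomog_mul_linear; apply/IM/h/ltnW.
exists (pmul K n d (var K i) (DHomog (pihomogP mdeg d q))).
  by apply: mem_up; apply/mem_graded_part => //=; apply: h.
by rewrite pihomog_mul_linear /= pmulE.
Qed.

Lemma mul_injective_colon I (L : R 1) d : is_ideal I -> mul_injective I L d ->
  graded_part (ideal_colon I L) d = graded_part I d.
Proof.
move=> hI injL; have [I0 ID IM] := hI.
apply/vspaceP => p; apply/idP/idP.
  move/(mem_graded_part _ (ideal_colonP _ hI)) => Ip.
  apply/mem_graded_part => //; have := injL p 0; rewrite subr0; apply.
  by rewrite mulr0 subr0 mulrC.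
move/(mem_graded_part _ hI) => Ip.
apply/mem_graded_part; first exact: ideal_colonP.
by rewrite /ideal_colon mulrC; apply: IM.
Qed.

Lemma graded_up_sub I d : is_ideal I ->
  (prodv (pmul K n) fullv (graded_part I d) <= graded_part I d.+1)%VS.
Proof.
move=> hI; have [_ _ IM] := hI; apply/prodvP => L p _ /(mem_graded_part _ hI) Ip.
by apply/mem_graded_part => //; rewrite pmulE; apply: IM.
Qed.

End GradedPieces.

(** * The theorem *)

Theorem theorem3p5 (K : fieldType) (n : nat) (I : {mpoly K[n.+1]} -> Prop)
    (K_infinite : infinite_field K)
    (I_ideal : is_ideal I) (I_homogeneous : is_homogeneous I) :
  for_general_linear_form (fun L : dhomog n.+1 K 1 =>
    forall (d e : nat) (a : nat -> nat),
      let J := ideal_trunc I d in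
      (2 <= e)%N ->
      binom_expansion (hilb I d) d e a ->
      (mul_injective I L d ->
        [<-> hilb (ideal_add I L) d = binom_shift (hilb I d) d (- 1) 0;
             maximal_growth (ideal_colon I L) d.-1;
             maximal_growth (ideal_colon J L) d.-1;
             maximal_growth J d])
      /\
      (mul_injective I L d.-1 ->
        [<-> hilb (ideal_add I L) d = binom_shift (hilb I d) d (- 1) 0;
             maximal_growth I d.-1;
             maximal_growth (ideal_colon J L) d.-1])).
Proof.
(* the open set is the whole space: see [colon_indep] for the comparison of [L]
   with a general form *)
exists (fun=> True); split=> [| |L _ d e a J e2 Wexp]; last 1 first.
have [m dE] : exists m, d = m.+2.
  by case: Wexp => /andP[_ /(leq_trans e2)]; case: d J => [|[|m]] //; exists m.
subst d.
have hilbE (A : {mpoly K[n.+1]} -> Prop) i :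
  hilb A i = codim (graded_part A i) by [].
rewrite /maximal_growth /= !hilbE !binom_shift_growth // binom_shift_restr //.
have J_ideal : is_ideal J := ideal_truncP I m.+2.
rewrite graded_add // !(graded_colon L _ J_ideal) !(graded_colon L _ I_ideal).
rewrite (graded_trunc_up _ I_ideal) (graded_trunc _ I_ideal).
have pC := @pmulC K n; have pG := @pmul_generated K n.
have pP d S := @pmul_prime K n S d.
have colon_bound := growth_colon_bound e2 Wexp.
have sharp := green_sharpP (pmul K n) L colon_bound.
split=> /(mul_injective_colon I_ideal); rewrite (graded_colon L _ I_ideal) => IL.
- have WL : (pmul K n m.+2 L @^-1: prodv (pmul K n) fullv (graded_part I m.+2))%VS
      = graded_part I m.+2.
    apply/eqP; rewrite eqEsubv (colon_up_sub (pmul K n)) andbT.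
    by rewrite -[X in (_ <= X)%VS]IL lpreimS // graded_up_sub.
  have into := sharp_iff_max_growing pC pG K_infinite pP WL colon_bound.
  rewrite IL WL; tfae=> //; [by move/sharp | by move/into | by move/into/sharp].
- have into := sharp_iff_colon_growth pC pG K_infinite pP
    (graded_up_sub m.+1 I_ideal) IL.
  move: sharp; rewrite IL => sharp; tfae;
    [by move/sharp | by move/into | by move/into/sharp].
- exists (fun f => f = 1%R) => L; split=> // _; exists 1%R => //.
  by rewrite rmorph1 oner_neq0.
- by exists 0%R.
Qed.
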